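(* For every integer $n\ge1$ there is a one-to-one correspondence (bijection) between the set $\mathrm{IPF}(n,n)$ of interval parking functions with $n$ cars and $n$ spots and the set $\mathscr F^e(n+1)$ of edge-labeled spanning trees of $K_{n+1}$.
   Context: Write $[n]=\{1,\dots,n\}$. An interval parking function with $n$ cars and $n$ spots is a pair $(a,b)$ with $a=(a_1,\dots,a_n)$, $b=(b_1,\dots,b_n)\in[n]^n$ such that all cars park in the following process: cars $1,\dots,n$ enter in order a one-way street with spots $1,\dots,n$; car $i$ goes to spot $a_i$ and parks in the first free spot that is $\ge a_i$, provided this spot is $\le b_i$ (car $i$ is only willing to park in the interval $[a_i,b_i]$); otherwise it fails to park. The set of these pairs is $\mathrm{IPF}(n,n)$. $\mathscr F^e(n+1)$ is the set of spanning trees of the complete graph $K_{n+1}$ on vertex set $\{0,1,\dots,n\}$ (rooted at vertex $0$) together with a labeling of the $n$ edges bijectively by $1,\dots,n$. *)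

(* Defs.v *)
From mathcomp Require Import all_boot.

Set Implicit Arguments.
Unset Strict Implicit.
Unset Printing Implicit Defensive.

(* Cars, spots and edge labels [n] = {1, ..., n} are represented by 'I_n: the
   ordinal i stands for i + 1. Vertices {0, ..., n} are the elements of
   'I_n.+1 themselves. *)

Section IntervalParking.
Variable n : nat.

(* [enum 'I_n] is increasing, so the head is the smallest suitable spot. *)
Definition first_free (occ : {set 'I_n}) (a : 'I_n) : option 'I_n :=
  ohead [seq j : 'I_n <- enum 'I_n | (a <= j) && (j \notin occ)].

Definition parking_spot (occ : {set 'I_n}) (a b : 'I_n) : option 'I_n :=
  if first_free occ a is Some j then if j <= b then Some j else None else None.

(* [cars] lists the pairs (a_i, b_i) of the cars still to enter; [occ] is the
   set of spots taken by the earlier cars. *)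
Fixpoint all_park (occ : {set 'I_n}) (cars : seq ('I_n * 'I_n)) : bool :=
  if cars is (a, b) :: cars' then
    if parking_spot occ a b is Some j then all_park (j |: occ) cars' else false
  else true.

Definition is_ipf (ab : n.-tuple 'I_n * n.-tuple 'I_n) : bool :=
  all_park set0 (zip ab.1 ab.2).

Definition IPF := {ab : n.-tuple 'I_n * n.-tuple 'I_n | is_ipf ab}.

End IntervalParking.

Section EdgeLabeledTrees.
Variable n : nat.
Notation vertex := 'I_n.+1.

(* Graphs on the vertex set {0, ..., n} are given by their edge sets, an edge
   being an unordered pair of distinct vertices. *)
Definition complete_graph : {set {set vertex}} :=
  [set e : {set vertex} | #|e| == 2].

Definition adj (E : {set {set vertex}}) : rel vertex :=
  fun x y => [set x; y] \in E.

Definition connected (E : {set {set vertex}}) : bool :=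
  [forall x, forall y, connect (adj E) x y].

(* A cycle visits distinct vertices, hence at most n.+1 of them; the bound
   2 < k excludes walking back and forth along a single edge. *)
Definition acyclic (E : {set {set vertex}}) : bool :=
  [forall k : 'I_n.+2, forall p : k.-tuple vertex,
     (2 < k) ==> ~~ ucycleb (adj E) p].

Definition is_spanning_tree (E : {set {set vertex}}) : bool :=
  [&& E \subset complete_graph, connected E & acyclic E].

(* Rooting at the fixed vertex 0 adds no data. *)
Definition spanning_tree := {E : {set {set vertex}} | is_spanning_tree E}.

Definition is_labeling (E : {set {set vertex}})
    (l : {ffun {e : {set vertex} | e \in E} -> 'I_n}) : bool :=
  injectiveb l && [forall k, exists e, l e == k].

Definition edge_labeling (E : {set {set vertex}}) :=
  {l : {ffun {e : {set vertex} | e \in E} -> 'I_n} | is_labeling l}.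

Definition edge_labeled_tree := {T : spanning_tree & edge_labeling (val T)}.

End EdgeLabeledTrees.

(* Main.v *)
Require Import Defs.
From mathcomp Require Import all_boot.

(* Both sets are finite and have n! (n+1)^(n-1) elements.

   Trees: orienting the edges of a spanning tree towards a root r identifies it
   with a map f fixing r whose iterates carry every vertex to r.  Maps whose
   iterates all end in fixed points are counted following Pitman: cutting such
   a map at one of its k+1 non-fixed points v (redefining f v := v) gives
   a map with k non-fixed points together with a point w = f v outside the tree
   of v, and for a given map the pairs (v, w) number |V| (|V| - k - 1).

   Parking: the final spots of the cars form a permutation, and a car parked in
   the spot numbered j from 0 admits n - j values of b_i, so each ordinary
   parking function underlies n! interval ones.  Following Pollak, ordinary
   parking functions are the sequences on a circle of n+1 spots that leave the
   last spot free; by rotation each spot is left free equally often. *)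

Set Implicit Arguments.
Unset Strict Implicit.
Unset Printing Implicit Defensive.

(** * Counting self-maps whose iterates all end in fixed points *)

Section FunctionalForests.
Variable V : finType.
Implicit Types (f g : {ffun V -> V}) (u v w : V).

(** A fixed point on the orbit of [v] is reached within [#|V|] steps, so in a forest this is the
    root of the tree containing [v]. *)
Definition top f v := iter #|V| f v.

Definition forest f := [forall v, f (top f v) == top f v].

Definition update f v w : {ffun V -> V} := [ffun u => if u == v then w else f u].

Lemma iter_fixed (f : V -> V) v k : f v = v -> iter k f v = v.
Proof. by move=> fv; elim: k => //= k ->. Qed.

Lemma iter_top f u k : f (iter k f u) = iter k f u -> iter k f u = top f u.
Proof.
move=> fixk; set x := iter k f u in fixk *.
have ux : fconnect f u x by exact: fconnect_iter.
have le_V : findex f u x <= #|V|.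
  by apply: ltnW; apply: leq_trans (findex_max ux) (max_card _).
by rewrite /top -(subnK le_V) iterD iter_findex // iter_fixed.
Qed.

Lemma forestP f :
  reflect (forall v, exists k, f (iter k f v) = iter k f v) (forest f).
Proof.
apply: (iffP forallP) => [Ff v | Ff v]; first by exists #|V|; apply/eqP/Ff.
by have [k fixk] := Ff v; rewrite -(iter_top fixk); apply/eqP.
Qed.

Lemma forest_top f v : forest f -> f (top f v) = top f v.
Proof. by move/forallP/(_ v)/eqP. Qed.

Lemma top_fixed f v : f v = v -> top f v = v.
Proof. exact: iter_fixed. Qed.

Lemma forest_cycle f v k : forest f -> iter k.+1 f v = v -> f v = v.
Proof.
move=> Ff loop.
have loopM m : iter (m * k.+1) f v = v.
  by elim: m => // m IHm; rewrite mulSn iterD IHm loop.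
(* Going round the loop [#|V|] times takes at least [#|V|] steps, hence ends in a fixed point; but
   it also ends in [v]. *)
have {}loopM := loopM #|V|.
have: #|V| <= #|V| * k.+1 by rewrite leq_pmulr.
move/subnK=> eqV; move: loopM; rewrite -eqV iterD iter_fixed ?forest_top // => <-.
exact: forest_top.
Qed.

Lemma updateE f v w u : update f v w u = if u == v then w else f u.
Proof. by rewrite ffunE. Qed.

Lemma updateK f v w : update (update f v w) v (f v) = f.
Proof. by apply/ffunP=> u; rewrite !updateE; case: eqP => // ->. Qed.

Lemma update_iter_away f v w u k :
  (forall j, iter j f u != v) -> iter k (update f v w) u = iter k f u.
Proof. by move=> away; elim: k => //= k ->; rewrite updateE (negPf (away k)). Qed.

(** An orbit that meets [v] now stops there, and any other orbit is unchanged. *)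
Lemma forest_cut f v : forest f -> forest (update f v v).
Proof.
move/forestP=> Ff; apply/forestP=> u; have [k] := Ff u.
elim: k u => [|k IHk] u /= fixk.
  by exists 0; rewrite /= updateE fixk; case: eqP.
have [-> | u'v] := eqVneq u v; first by exists 0; rewrite /= updateE eqxx.
have [|j fixj] := IHk (f u); first by rewrite -iterSr.
have gu : update f v v u = f u by rewrite updateE (negPf u'v).
by exists j.+1; rewrite iterSr gu.
Qed.

(** Iterates of the cut map are iterates of [f], so reaching [v] from [f v] would put [v] on a cycle
    of [f]. *)
Lemma top_cut f v : forest f -> f v != v -> top (update f v v) (f v) != v.
Proof.
move=> Ff; apply: contraNneq; set g := update f v v => topv.
have sim u k : exists j, iter k g u = iter j f u.
  elim: k => [|k [j IHk]] /=; first by exists 0.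
  rewrite IHk /g updateE; case: eqP => [<- | _]; first by exists j.
  by exists j.+1.
have [j Dj] := sim (f v) #|V|; apply/eqP.
by apply: (@forest_cycle f v j) => //; rewrite iterSr -Dj.
Qed.

(** Orbits in trees other than that of [v] never meet [v] and survive unchanged; this covers the
    orbit of [w]. An orbit in the tree of [v] reaches [v], passes to [w], and then follows that
    one. *)
Lemma forest_graft g v w :
  forest g -> g v = v -> top g w != v -> forest (update g v w).
Proof.
move=> Fg gv topw; set f := update g v w.
have off u : top g u != v -> exists k, f (iter k f u) = iter k f u.
  move=> topu; have away j : iter j g u != v.
    apply: contraNneq topu => ju.
    by rewrite -(@iter_top g u j) ?ju.
  exists #|V|; rewrite update_iter_away // updateE (negPf topu).
  exact: forest_top.
have fv : f v = w by rewrite updateE eqxx.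
apply/forestP=> u; have [topu | /off //] := eqVneq (top g u) v.
move: topu; rewrite /top; elim: #|V| u => [|k IHk] u.
  move=> /= ->; have [k fixk] := off w topw.
  by exists k.+1; rewrite iterSr fv.
have [-> _ | u'v] := eqVneq u v.
  have [j fixj] := off w topw.
  by exists j.+1; rewrite iterSr fv.
rewrite iterSr => /IHk[j fixj].
have fu : f u = g u by rewrite /f updateE (negPf u'v).
by exists j.+1; rewrite iterSr fu.
Qed.

Definition moved f := [set v | f v != v].

Definition forests k := [set f | forest f & #|moved f| == k].

Lemma moved_cut f v : moved (update f v v) = moved f :\ v.
Proof. by apply/setP=> u; rewrite !inE updateE; have [->|] := eqVneq u v; rewrite ?eqxx. Qed.

Lemma card_forests_step k :
  k.+1 * #|forests k.+1| = #|V| * (#|V| - k.+1) * #|forests k|.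
Proof.
(* Double counting: [A] holds the maps with a point to cut, [B] the maps with a root [v] and a
   vertex [w] to graft it on, outside the tree of [v]. *)
pose A := [set p : {ffun V -> V} * V | (p.1 \in forests k.+1) && (p.1 p.2 != p.2)].
pose B := [set q : {ffun V -> V} * (V * V) |
  [&& q.1 \in forests k, q.1 q.2.1 == q.2.1 & top q.1 q.2.2 != q.2.1]].
pose cut (p : {ffun V -> V} * V) := (update p.1 p.2 p.2, (p.2, p.1 p.2)).
have cutK : injective cut.
  move=> [f v] [f' v'] [eq_upd eq_v eq_fv]; congr (_, _) => //.
  by rewrite -(updateK f v v) eq_upd eq_fv eq_v updateK.
have cutA : cut @: A = B.
  apply/setP=> [[g [v w]]]; apply/imsetP/idP => [[[f u]] | ].
    rewrite !inE /= => /andP[/andP[Ff /eqP cardf] fu] [-> -> ->].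
    rewrite forest_cut // moved_cut updateE !eqxx top_cut //= andbT.
    by have := cardsD1 u (moved f); rewrite cardf inE fu add1n => -[<-].
  rewrite !inE /= => /and3P[/andP[Fg /eqP cardg] /eqP gv topw].
  have vw : w != v by apply: contraNneq topw => ->; rewrite top_fixed.
  exists (update g v w, v); last first.
    by rewrite /cut /= updateE eqxx -{1}(updateK g v w) gv.
  rewrite !inE /= updateE eqxx vw andbT forest_graft //=.
  have ->: moved (update g v w) = v |: moved g.
    by apply/setP=> u; rewrite !inE updateE; have [->|] := eqVneq u v; rewrite ?vw.
  by rewrite cardsU1 !inE gv eqxx cardg.
have cardA : #|A| = k.+1 * #|forests k.+1|.
  transitivity (\sum_(f in forests k.+1) \sum_(v in moved f) 1).
    rewrite pair_big_dep /= sum1_card -cardsE.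
    by apply: eq_card => -[f v]; rewrite !inE unfold_in /= !inE.
  rewrite mulnC -sum_nat_const; apply: eq_bigr => f.
  by rewrite sum1_card inE => /andP[_ /eqP].
rewrite -cardA -(card_imset _ cutK) cutA.
(* Choosing [w] first makes the count uniform: [v] is then any of the [#|V| - k] fixed points except
   [top g w]. *)
transitivity (\sum_(g in forests k) \sum_w \sum_(v | (g v == v) && (top g w != v)) 1).
  pose sw (q : {ffun V -> V} * (V * V)) := (q.1, (q.2.2, q.2.1)).
  have sw_inj : injective sw by move=> [g [v w]] [g' [v' w']] [-> -> ->].
  rewrite -(card_imset _ sw_inj).
  under eq_bigr => g _ do rewrite pair_big_dep /=.
  rewrite pair_big_dep /= sum1_card; apply: eq_card => -[g [w v]].
  rewrite [RHS]unfold_in /=.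
  apply/imsetP/idP => [[[g' [v' w']]] | gvw]; first by rewrite inE => ? [-> -> ->].
  by exists (g, (v, w)); rewrite // inE.
rewrite mulnC -sum_nat_const; apply: eq_bigr => g.
rewrite inE => /andP[Fg /eqP cardg]; rewrite -sum_nat_const; apply: eq_bigr => w _.
rewrite sum1_card -cardsE.
have ->: [set v | (g v == v) && (top g w != v)] = ~: (top g w |: moved g).
  by apply/setP=> v; rewrite !inE negb_or negbK andbC eq_sym.
by rewrite cardsCs setCK cardsU1 !inE forest_top // eqxx cardg.
Qed.

Lemma card_forests0 : #|forests 0| = 1.
Proof.
rewrite -(cards1 [ffun v : V => v]); congr #|pred_of_set _|.
apply/setP=> f; rewrite !inE cards_eq0; apply/andP/eqP => [[_ /eqP m0] | ->].
  by apply/ffunP=> v; rewrite ffunE; have := in_set0 v; rewrite -m0 inE => /negbFE/eqP.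
split; first by apply/forallP=> v; rewrite ffunE.
by apply/eqP/setP=> v; rewrite !inE ffunE eqxx.
Qed.

Lemma card_forests k : k <= #|V| ->
  k`! * #|forests k| = #|V| ^ k * (#|V|.-1 ^_ k).
Proof.
elim: k => [|k IHk] ltk; first by rewrite card_forests0.
rewrite factS [_ * k`!]mulnC -mulnA card_forests_step mulnCA IHk 1?ltnW //.
rewrite expnS ffactnSr -subn1 -subnDA add1n.
by rewrite -!mulnA; congr (_ * _); rewrite mulnCA; congr (_ * _); rewrite mulnC.
Qed.

(** For nonempty [V] these maps have exactly one fixed point, so they are the rooted trees on
    [V]. *)
Lemma card_forests_max : #|forests #|V|.-1| = #|V| ^ #|V|.-1.
Proof.
apply/eqP; rewrite -(eqn_pmul2l (fact_gt0 #|V|.-1)) card_forests ?leq_pred //.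
by rewrite ffactnn mulnC.
Qed.

End FunctionalForests.

(** * Spanning trees as maps sending each vertex to its parent *)

Section TreesAsParentMaps.
Variables (n : nat) (r : 'I_n.+1).
Notation vertex := 'I_n.+1.
Implicit Types (f g : {ffun vertex -> vertex}) (E : {set {set vertex}}).

(** The root is an arbitrary [r] rather than 0 because the forest count gives a sum over all
    roots. *)
Definition parent_maps :=
  [set f : {ffun vertex -> vertex} | (f r == r) && [forall v, fconnect f v r]].

Definition edges f : {set {set vertex}} := [set [set v; f v] | v in [set~ r]].

Lemma parent_mapP f : f \in parent_maps -> f r = r /\ forall v, fconnect f v r.
Proof. by rewrite inE => /andP[/eqP fr /forallP]. Qed.

Lemma parent_map_ind f (P : vertex -> Prop) : f \in parent_maps ->
  P r -> (forall v, v != r -> P (f v) -> P v) -> forall v, P v.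
Proof.
move=> /parent_mapP[_ Tf] Pr Pstep v.
have := iter_findex (Tf v); move: (findex f v r) => m; elim: m v {Tf} => [|k IHk] v; first by move=> /= ->.
have [-> // | v'r] := eqVneq v r.
by rewrite iterSr => /IHk; apply: Pstep.
Qed.

Lemma findex_parent f v : f \in parent_maps -> v != r ->
  findex f v r = (findex f (f v) r).+1.
Proof. by move=> /parent_mapP[_ Tf]; rewrite eq_sym; apply: fconnect_findex. Qed.

(** The distance to [r] drops by one at each step from a vertex other than [r], so two such steps
    cannot return to [v]. *)
Lemma parent_map_cycle2 f v : f \in parent_maps -> v != r -> f (f v) != v.
Proof.
move=> Tf v'r; apply/eqP=> ffv; have := findex_parent Tf v'r.
have [fv | fv'r] := eqVneq (f v) r.
  by have [fr _] := parent_mapP Tf; rewrite -ffv fv fr eqxx in v'r.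
rewrite (findex_parent Tf fv'r) ffv => /eqP.
by rewrite -addn2 -[X in X == _]addn0 eqn_add2l.
Qed.

Lemma parent_map_neq f v : f \in parent_maps -> v != r -> f v != v.
Proof.
by move=> Tf v'r; apply: contraNneq (parent_map_cycle2 Tf v'r) => fv; rewrite !fv.
Qed.

Lemma set2_eq (T : finType) (x y z w : T) : [set x; y] = [set z; w] ->
  x = z /\ y = w \/ x = w /\ y = z.
Proof.
move=> eqS.
have: x \in [set z; w] by rewrite -eqS set21.
have: y \in [set z; w] by rewrite -eqS set22.
have: z \in [set x; y] by rewrite eqS set21.
have: w \in [set x; y] by rewrite eqS set22.
rewrite !inE.
by do 4![case/orP=> /eqP ?]; subst; auto.
Qed.

Lemma adj_sym E : symmetric (adj E).
Proof. by move=> x y; rewrite /adj setUC. Qed.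

Lemma adj_edges f x y : adj (edges f) x y ->
  x != r /\ f x = y \/ y != r /\ f y = x.
Proof.
case/imsetP=> v; rewrite !inE => v'r /set2_eq[[-> ->] | [-> ->]]; first by left.
by right.
Qed.

Lemma edge_parent f v : v != r -> adj (edges f) v (f v).
Proof. by move=> v'r; apply/imsetP; exists v; rewrite ?inE. Qed.

Lemma edges_connected f : f \in parent_maps -> connected (edges f).
Proof.
move=> Tf; have to_root: forall v, connect (adj (edges f)) v r.
  apply: (parent_map_ind Tf) => // v v'r; apply: connect_trans.
  exact/connect1/edge_parent.
apply/forallP=> x; apply/forallP=> y; apply: connect_trans (to_root x) _.
by rewrite (sym_connect_sym (@adj_sym _)).
Qed.

(* Both neighbours on a cycle of its deepest vertex m would have to be f m. *)
Lemma edges_acyclic f : f \in parent_maps -> acyclic (edges f).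
Proof.
move=> Tf; apply/forallP=> k; apply/forallP=> p; apply/implyP=> k_gt2; apply/negP.
have [p0 p0P] : exists x, x \in p.
  by exists (tnth p (Ordinal (ltnW (ltnW k_gt2)))); apply: mem_tnth.
have [m m_p max_m] := @arg_maxnP _ p0 (mem p) (fun v => findex f v r) p0P.
have nbr x : x \in p -> adj (edges f) m x -> x = f m.
  move=> x_p /adj_edges[[_ <-] // | [x'r fx]].
  by have := max_m x x_p; rewrite /= (findex_parent Tf x'r) fx ltnn.
have [i q Dp] := rot_to m_p.
have sizep : size (m :: q) = k by rewrite -Dp size_rot size_tuple.
have memp x : x \in m :: q -> x \in p by rewrite -Dp mem_rot.
rewrite /ucycleb -(rot_cycle i) -(rot_uniq i) Dp => /andP[].
case: q sizep memp {Dp} => [|y [|z q]] /=; rewrite ?rcons_path;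
  try by move=> Dk; rewrite -Dk in k_gt2.
move=> _ memp /and3P[adj_my _ /andP[_ adj_lm]] /and3P[_ /negP y_q _].
apply: y_q; have /nbr -> // : y \in p by apply: memp; rewrite !inE eqxx orbT.
have <- : last z q = f m; last exact: mem_last.
apply: nbr; last by rewrite adj_sym.
by apply: memp; rewrite 2!in_cons mem_last !orbT.
Qed.

Lemma edges_tree f : f \in parent_maps -> is_spanning_tree (edges f).
Proof.
move=> Tf; rewrite /is_spanning_tree edges_connected ?edges_acyclic // !andbT.
apply/subsetP=> e /imsetP[v]; rewrite !inE => v'r ->.
by rewrite cards2 (eq_sym v) parent_map_neq.
Qed.

(* If f and g agree at g v but not at v, then v - g v being an edge of f forces
   f (g v) = v, hence g (g v) = v, which is impossible. *)
Lemma edges_inj : {in parent_maps &, injective edges}.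
Proof.
move=> f g Tf Tg eqE; have [fr _] := parent_mapP Tf; have [gr _] := parent_mapP Tg.
apply/ffunP; apply: (parent_map_ind Tg) => [|v v'r eq_w]; first by rewrite fr gr.
have: adj (edges f) v (g v) by rewrite eqE edge_parent.
case/adj_edges=> [[] // | [gv'r fgv]].
by have := parent_map_cycle2 Tg v'r; rewrite -eq_w fgv eqxx.
Qed.

Lemma card_edges f : f \in parent_maps -> #|edges f| = n.
Proof.
move=> Tf; rewrite card_in_imset ?cardsC1 ?card_ord // => v w.
rewrite !inE => v'r w'r /set2_eq[[] // | [Dv Dw]].
by have := parent_map_cycle2 Tf v'r; rewrite Dw -Dv eqxx.
Qed.

(** Walks to [r] of length exactly [k]; being a boolean predicate, it lets [ex_minn] extract the
    distance to [r]. *)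
Fixpoint reach E k v := if k is k'.+1 then [exists w, adj E v w && reach E k' w] else v == r.

Lemma connected_reach E v : connected E -> exists k, reach E k v.
Proof.
move=> /forallP/(_ v)/forallP/(_ r)/connectP[p].
elim: p v => [|w p IHp] v /= => [_ <- | /andP[vw /IHp p_r] /p_r[k kP]]; first by exists 0 => /=.
by exists k.+1; apply/existsP; exists w; rewrite vw.
Qed.

(** Breadth-first search: the parent of [v] is a neighbour strictly closer to [r]. *)
Lemma connected_parent_map E : connected E ->
  exists2 f, f \in parent_maps & edges f \subset E.
Proof.
move=> conE; pose d v := ex_minn (connected_reach v conE).
have step v : v != r -> exists w, adj E v w && (d w < d v).
  move=> v'r; rewrite {2}/d; case: ex_minnP => -[|k] /=; first by rewrite (negPf v'r).
  case/existsP=> w /andP[vw wk] _; exists w; rewrite vw ltnS /d.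
  by case: ex_minnP => j _; apply.
(* By [step] the [pick] always succeeds away from [r], so the default of [odflt] is never
   returned. *)
pose f := [ffun v => if v == r then r else odflt r [pick w | adj E v w && (d w < d v)]].
have fP v : v != r -> adj E v (f v) && (d (f v) < d v).
  move=> v'r; rewrite ffunE (negPf v'r); case: pickP => //= none.
  by have [w] := step v v'r; rewrite none.
exists f.
  rewrite inE {1}ffunE !eqxx /=; apply/forallP=> v.
  have [m] := ubnP (d v); elim: m v => // m IHm v; rewrite ltnS => le_m.
  have [-> | v'r] := eqVneq v r; first exact: connect0.
  have /andP[_ lt_d] := fP v v'r.
  apply: connect_trans (fconnect1 f v) (IHm _ _).
  exact: leq_trans lt_d le_m.
apply/subsetP=> e /imsetP[v]; rewrite !inE => v'r ->.
by have /andP[] := fP v v'r.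
Qed.

(** An edge of [E] missing from [F] would close a path of [F] between its ends into a cycle of
    [E]. *)
Lemma acyclic_sub_connected E (F : {set {set vertex}}) : E \subset complete_graph n -> acyclic E ->
  F \subset E -> connected F -> F = E.
Proof.
move=> simpleE acyE sFE conF; apply/eqP; rewrite eqEsubset sFE /=.
apply/subsetP=> e eE; have := subsetP simpleE e eE.
rewrite inE => /cards2P[x [y [x'y De]]]; subst e.
apply: contraLR acyE => xyF.
have /forallP/(_ x)/forallP/(_ y)/connectP[p0 p0P p0y] := conF.
subst y; case: (shortenP p0P) x'y xyF eE => p pP Up _ x'y xyF eE.
have ltp : size (x :: p) < n.+2.
  by have := max_card (mem (x :: p)); rewrite (card_uniqP Up) card_ord.
apply/forallPn; exists (Ordinal ltp); apply/forallPn; exists (in_tuple (x :: p)).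
rewrite negb_imply negbK -[X in ucycleb _ X]/(x :: p) /ucycleb Up andbT.
rewrite /cycle rcons_path [adj E _ _]/adj setUC eE andbT.
rewrite /= (sub_path _ pP) ?andbT; last by move=> u v; apply: (subsetP sFE).
(* The cycle has more than two vertices: one vertex would give equal ends, and two would put the
   edge itself in [F]. *)
case: p pP x'y xyF {Up ltp eE} => [|z [|z' p]] //=; first by rewrite eqxx.
by rewrite andbT /adj => ->.
Qed.

Lemma edges_onto : edges @: parent_maps = [set E | is_spanning_tree E].
Proof.
apply/setP=> E; rewrite inE; apply/imsetP/idP => [[f Tf ->] | ].
  exact: edges_tree.
case/and3P=> simpleE conE acyE; have [f Tf sfE] := connected_parent_map conE.
by exists f; rewrite // (acyclic_sub_connected simpleE acyE sfE) ?edges_connected.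
Qed.

Lemma card_parent_maps : #|parent_maps| = #|{: spanning_tree n}|.
Proof. by rewrite -(card_in_imset edges_inj) edges_onto cardsE card_sig. Qed.

Lemma card_spanning_tree (E : spanning_tree n) : #|val E| = n.
Proof.
have: val E \in edges @: parent_maps by rewrite edges_onto inE (valP E).
by case/imsetP=> f Tf ->; apply: card_edges.
Qed.

End TreesAsParentMaps.

(** * Counting edge labelings and spanning trees *)

Lemma card_edge_labeling n (E : {set {set 'I_n.+1}}) : #|E| = n ->
  #|{: edge_labeling E}| = n`!.
Proof.
move=> cardE; have cardT : #|{: {e : {set 'I_n.+1} | e \in E}}| = n.
  by rewrite card_sig -[RHS]cardE; apply: eq_card.
(* There are as many edges as labels, so labelings are just the injections, counted by a falling
   factorial. *)
have -> : n`! = #|'I_n| ^_ #|{: {e : {set 'I_n.+1} | e \in E}}|.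
  by rewrite cardT card_ord ffactnn.
rewrite card_sig -card_inj_ffuns; apply: eq_card => l; rewrite !inE /is_labeling.
case: injectiveP => //= l_inj; apply/forallP=> k.
have /mapP[e _ ->] : k \in codom l by apply: inj_card_onto; rewrite // cardT card_ord.
by apply/existsP; exists e.
Qed.

Lemma card_edge_labeled_tree n : #|{: edge_labeled_tree n}| = #|{: spanning_tree n}| * n`!.
Proof.
rewrite card_tagged sumnE big_map big_enum -sum_nat_const.
by apply: eq_bigr => E _; rewrite card_edge_labeling // (card_spanning_tree ord0).
Qed.

(** Of [n.+1] vertices only one is not moved by a forest in [forests 'I_n.+1 n]; it is the end of
    every orbit, so the forest is a parent map for exactly one root. *)
Lemma card_rooted n : \sum_(r : 'I_n.+1) #|parent_maps r| = #|forests 'I_n.+1 n|.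
Proof.
transitivity (\sum_r \sum_(f in forests 'I_n.+1 n | f r == r) 1).
  apply: eq_bigr => r _; rewrite -sum1_card; apply: eq_bigl => f.
  apply/idP/idP => [Tf | /andP[]].
    have [fr reach_r] := parent_mapP Tf; rewrite inE fr eqxx andbT.
    apply/andP; split; first by apply/forestP=> v; exists (findex f v r); rewrite iter_findex.
    rewrite (_ : moved f = [set~ r]) ?cardsC1 ?card_ord //.
    apply/setP=> v; rewrite !inE; have [-> | v'r] := eqVneq v r; first by rewrite fr eqxx.
    exact: parent_map_neq Tf v'r.
  rewrite inE => /andP[Ff /eqP cardf] /eqP fr.
  have fixed v : f v = v -> v = r.
    move=> fv; apply/eqP; apply: contraTT isT => v'r.
    have: [set v; r] \subset ~: moved f.
      by apply/subsetP=> u /set2P[] ->; rewrite !inE negbK ?fv ?fr.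
    by move/subset_leq_card; rewrite cards2 v'r cardsCs setCK cardf card_ord subSnn.
  rewrite inE fr eqxx; apply/forallP=> v.
  by rewrite -(fixed _ (forest_top v Ff)) fconnect_iter.
rewrite (exchange_big_dep (mem (forests 'I_n.+1 n))) /=; last by move=> ? ? _ /andP[].
rewrite -sum1_card; apply: eq_bigr => f fF.
have:= fF; rewrite inE => /andP[Ff /eqP cardf].
rewrite (eq_bigl (fun v => v \in ~: moved f)) => [|v]; last by rewrite Ff cardf eqxx !inE negbK.
by rewrite sum1_card cardsCs setCK cardf card_ord subSnn.
Qed.

(** Cayley's formula multiplied by [n.+1]: every root contributes the same number of parent maps,
    namely that of spanning trees. *)
Lemma card_spanning_trees n : n.+1 * #|{: spanning_tree n}| = n.+1 ^ n.
Proof.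
have := card_forests_max 'I_n.+1; rewrite card_ord -card_rooted.
under eq_bigr => r _ do rewrite card_parent_maps.
by rewrite sum_nat_const card_ord.
Qed.

(** * Parking on a circle *)

Lemma card_tuple_cons (T : finType) m (P : pred (seq T)) :
  #|[set t : m.+1.-tuple T | P t]| = \sum_x #|[set t : m.-tuple T | P (x :: t)]|.
Proof.
rewrite -sum1_card (eq_bigl (fun t : m.+1.-tuple T => P t)); last first.
  by move=> t; rewrite inE.
rewrite (reindex (fun p : T * m.-tuple T => [tuple of p.1 :: p.2])) /=; last first.
  exists (fun t : m.+1.-tuple T => (thead t, [tuple of behead t])) => [[x t] _|t _].
    by congr (_, _); apply: val_inj.
  by rewrite -tuple_eta.
rewrite -(pair_big_dep xpredT (fun x (t : m.-tuple T) => P (x :: t)) (fun _ _ => 1)) /=.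
by apply: eq_bigr => x _; rewrite sum1_card cardsE.
Qed.

Section CircularParking.
Variable N : nat.
Implicit Types (S : {set 'I_N}) (a x : 'I_N).

(** [ordS] is the cyclic successor, and [find] gives the number of steps to take from [a]. If [S] is
    full, it gives [N], which leads back to [a]. *)
Definition circ_free S a :=
  iter (find (fun k => iter k (@ordS N) a \notin S) (iota 0 N)) (@ordS N) a.

Fixpoint circ_park S (s : seq 'I_N) :=
  if s is a :: s' then circ_park (circ_free S a |: S) s' else S.

Lemma val_iter_ordS a k : iter k (@ordS N) a = (a + k) %% N :> nat.
Proof.
elim: k => [|k IHk] /=; first by rewrite addn0 modn_small.
by rewrite IHk -addn1 modnDml addn1 addnS.
Qed.

Lemma circ_free_notin S a : S != setT -> circ_free S a \notin S.
Proof.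
rewrite -subTset => /subsetPn[x _ xS].
have hasN : has (fun k => iter k (@ordS N) a \notin S) (iota 0 N).
  (* The witness is the number of steps from [a] to [x] around the circle. *)
  apply/hasP; exists ((x + (N - a)) %% N).
    by rewrite mem_iota ltn_mod (leq_ltn_trans _ (ltn_ord a)).
  rewrite (_ : iter _ _ _ = x) //; apply: val_inj; rewrite /= val_iter_ordS modnDmr.
  by rewrite addnCA subnKC 1?ltnW // modnDr modn_small.
by have := nth_find 0 hasN; rewrite nth_iota //; move: hasN; rewrite has_find size_iota.
Qed.

(** The search that does not run past the last spot; this is the case that compares the circle with
    the street. *)
Lemma circ_free_eq S a (j : 'I_N) : a <= j -> j \notin S ->
  (forall i : 'I_N, a <= i < j -> i \in S) -> circ_free S a = j.
Proof.
move=> le_aj jS before.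
have iterE k : k <= j - a -> iter k (@ordS N) a = a + k :> nat.
  move=> le_k; rewrite val_iter_ordS modn_small //.
  by rewrite (leq_ltn_trans _ (ltn_ord j)) // -(subnKC le_aj) leq_add2l.
have iterj : iter (j - a) (@ordS N) a = j.
  by apply: val_inj; rewrite /= iterE // subnKC.
suff ->: circ_free S a = iter (j - a) (@ordS N) a by [].
congr (iter _ _ _).
have lt_N : j - a < N by rewrite (leq_ltn_trans (leq_subr _ _)).
have -> : iota 0 N = iota 0 (j - a) ++ iota (j - a) (N - (j - a)).-1.+1.
  by rewrite -[X in iota X _.+1]add0n -iotaD prednK ?subn_gt0 // subnKC // ltnW.
rewrite find_cat size_iota.
have -> : has (fun k => iter k (@ordS N) a \notin S) (iota 0 (j - a)) = false.
  apply/hasP=> -[k]; rewrite mem_iota /= add0n => lt_k; apply/negP; rewrite negbK.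
  by apply: before; rewrite iterE ?leq_addr -?ltn_subRL //= ltnW.
by rewrite /= iterj jS addn0.
Qed.

Lemma circ_free_ordS S a : circ_free (@ordS N @: S) (ordS a) = ordS (circ_free S a).
Proof.
rewrite /circ_free -iterSr /=; congr (ordS (iter _ _ _)).
by apply: eq_find => k; rewrite -iterSr /= mem_imset //; apply: ordS_inj.
Qed.

Lemma circ_park_ordS S s :
  circ_park (@ordS N @: S) (map (@ordS N) s) = @ordS N @: circ_park S s.
Proof. by elim: s S => //= a s IHs S; rewrite circ_free_ordS -imsetU1 IHs. Qed.

Lemma sub_circ_park S s : S \subset circ_park S s.
Proof.
by elim: s S => //= a s IHs S; apply: subset_trans (IHs _); rewrite subsetUr.
Qed.

Lemma card_circ_park S s : #|S| + size s <= N -> #|circ_park S s| = #|S| + size s.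
Proof.
elim: s S => [|a s IHs] S /=; first by rewrite addn0.
rewrite addnS -addSn => leN.
have cardS : #|circ_free S a |: S| = #|S|.+1.
  rewrite cardsU1 circ_free_notin //; apply: contraTneq leN => ->.
  by rewrite cardsT card_ord addSn ltnNge leq_addr.
by rewrite IHs cardS.
Qed.

Definition leaving x m S := #|[set t : m.-tuple 'I_N | x \notin circ_park S t]|.

Lemma leaving_cons x m S :
  leaving x m.+1 S = \sum_a leaving x m (circ_free S a |: S).
Proof. exact: (card_tuple_cons m (fun s => x \notin circ_park S s)). Qed.

Lemma leaving_full x m S : x \in S -> leaving x m S = 0.
Proof.
move=> xS; apply/eqP; rewrite cards_eq0; apply/eqP/setP=> t.
by rewrite !inE (subsetP (sub_circ_park _ _)).
Qed.

(** Rotating all preferences by one spot permutes the sequences and rotates the final set of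
    occupied spots. *)
Lemma leaving_ordS x m : leaving (ordS x) m set0 = leaving x m set0.
Proof.
pose rot (t : m.-tuple 'I_N) := map_tuple (@ordS N) t.
have rot_inj : injective rot.
  by move=> t t' /(congr1 val) /(inj_map (@ordS_inj N)) /val_inj.
rewrite /leaving -(card_preimset _ rot_inj); apply: eq_card => t.
rewrite !inE /= -[set0](imset0 (@ordS N)) circ_park_ordS imset0 mem_imset //.
exact: ordS_inj.
Qed.

Lemma leaving_const x y m : leaving x m set0 = leaving y m set0.
Proof.
have leaving_iter k : leaving (iter k (@ordS N) x) m set0 = leaving x m set0.
  by elim: k => //= k IHk; rewrite leaving_ordS.
rewrite -(leaving_iter (y + (N - x))); congr (leaving _ m set0).
apply: val_inj; rewrite /= val_iter_ordS.
by rewrite addnCA subnKC 1?ltnW // modnDr modn_small.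
Qed.

End CircularParking.

(** After [n] cars exactly one of the [n.+1] spots is free, so summing over the spots counts each
    preference sequence once. *)
Lemma leaving_total n (x : 'I_n.+1) : n.+1 * leaving x n set0 = n.+1 ^ n.
Proof.
rewrite -[LHS]addn0 -[X in X * _]card_ord -sum_nat_const addn0.
under eq_bigr => y _ do rewrite (leaving_const x y) /leaving -sum1dep_card.
rewrite (exchange_big_dep xpredT) //=.
have <- : #|{: n.-tuple 'I_n.+1}| = n.+1 ^ n by rewrite card_tuple card_ord.
rewrite -sum1_card.
apply: eq_bigr => t _; rewrite sum1_card -cardsE.
rewrite (_ : [set _ | _] = ~: circ_park set0 t); last by apply/setP=> y; rewrite !inE.
by rewrite cardsCs setCK card_ord card_circ_park cards0 size_tuple ?subSnn.
Qed.

(** * Parking on the street, compared with the circle *)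

Section LinearParking.
Variable n : nat.
Implicit Types (S : {set 'I_n}) (a j : 'I_n).

Let widen : 'I_n -> 'I_n.+1 := widen_ord (leqnSn n).

Lemma widen_inj : injective widen.
Proof. by move=> i j /(congr1 val) /= /val_inj. Qed.

Lemma first_freeP S a :
  if first_free S a is Some j
  then [/\ a <= j, j \notin S & forall i : 'I_n, a <= i < j -> i \in S]
  else forall i : 'I_n, a <= i -> i \in S.
Proof.
rewrite /first_free.
have: sorted (relpre val ltn) (enum 'I_n).
  by rewrite -sorted_map val_enum_ord iota_ltn_sorted.
move/(sorted_filter (fun y x z : 'I_n => @ltn_trans y x z)
  (fun j : 'I_n => (a <= j) && (j \notin S))).
have memF i : (i \in [seq j : 'I_n <- enum 'I_n | (a <= j) && (j \notin S)])
    = (a <= i) && (i \notin S).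
  by rewrite mem_filter mem_enum andbT.
case: filter memF => [|j s] memF /= sorted_s => [i le_ai | ].
  by have := memF i; rewrite in_nil le_ai /= => /esym/negbFE.
have /andP[le_aj jS] : (a <= j) && (j \notin S) by rewrite -memF mem_head.
split=> // i /andP[le_ai lt_ij]; apply: contraLR lt_ij => iS.
have : i \in j :: s by rewrite memF le_ai.
rewrite inE -leqNgt => /predU1P[-> // | i_s].
have /allP/(_ i i_s) := order_path_min (fun y x z : 'I_n => @ltn_trans y x z) sorted_s.
exact: ltnW.
Qed.

Lemma max_notin_widen S : ord_max \notin widen @: S.
Proof.
by apply/imsetP=> -[i _ /(congr1 val) /= eq_n]; have := ltn_ord i; rewrite -eq_n ltnn.
Qed.

(* The extra spot of the circle receives the cars that fail to park. *)
Lemma circ_free_widen S a :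
  circ_free (widen @: S) (widen a) =
  if first_free S a is Some j then widen j else ord_max.
Proof.
have widenP (i : 'I_n.+1) : i < n -> exists i', i = widen i'.
  by move=> lt_in; exists (Ordinal lt_in); apply: val_inj.
case: first_free (first_freeP S a) => [j [le_aj jS before] | before].
  apply: circ_free_eq => //; first by rewrite mem_imset //; apply: widen_inj.
  move=> i /andP[le_ai lt_ij].
  have [i' Di] := widenP i (ltn_trans lt_ij (ltn_ord j)).
  by rewrite Di in le_ai lt_ij *; rewrite imset_f // before // le_ai.
apply: circ_free_eq => /=; first by rewrite ltnW.
  exact: max_notin_widen.
move=> i /andP[le_ai /widenP[i' Di]].
by rewrite Di in le_ai *; rewrite imset_f ?before.
Qed.

Lemma circ_free_max S : circ_free (widen @: S) ord_max = ord_max.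
Proof.
apply: circ_free_eq => //.
  exact: max_notin_widen.
by move=> i /= /andP[/leq_ltn_trans/[apply]]; rewrite ltnn.
Qed.

Definition parkings m S := #|[set t : m.-tuple ('I_n * 'I_n) | all_park S t]|.

(** The bound [b] of the first car affects only whether it accepts its spot [j], and [n - j] values
    of [b] do. *)
Lemma parkings_cons m S :
  parkings m.+1 S =
  \sum_a if first_free S a is Some j then (n - j) * parkings m (j |: S) else 0.
Proof.
rewrite /parkings (card_tuple_cons m (all_park S)) /=.
transitivity (\sum_a \sum_b #|[set t : m.-tuple ('I_n * 'I_n) |
  if parking_spot S a b is Some j then all_park (j |: S) t else false]|).
  by rewrite pair_bigA; apply: eq_bigr => -[a b] _.
apply: eq_bigr => a _; rewrite /parking_spot.
case: first_free => [j|]; last by rewrite big1 // => b _; apply: eq_card0 => t; rewrite inE.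
rewrite (bigID (fun b : 'I_n => j <= b)) /= addnC big1 ?add0n; last first.
  by move=> b /negPf ->; apply: eq_card0 => t; rewrite inE.
under eq_bigr => b -> do [].
rewrite sum_nat_const; congr (_ * _).
have cardlt : \sum_(b < n | b < j) 1 = j.
  by rewrite -(big_ord_widen n (fun=> 1)) ?sum1_card ?card_ord // ltnW.
have := sum1_card 'I_n; rewrite (bigID (fun b : 'I_n => b < j)) /= cardlt card_ord => split_n.
apply: (@addnI j); rewrite subnKC 1?ltnW // -[RHS]split_n sum1_card; congr (_ + _).
by apply: eq_card => b; rewrite [RHS]unfold_in /= -leqNgt.
Qed.

(** There are as many cars left as free spots, so if all park, each free spot [j] is taken exactly
    once. The factors [n - j] then have the same product whatever the order of the spots. *)
Lemma parkings_leaving m S : m + #|S| = n ->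
  parkings m S = (\prod_(j in ~: S) (n - j)) * leaving ord_max m (widen @: S).
Proof.
elim: m S => [|m IHm] S cardS.
  have -> : S = setT by apply/eqP; rewrite eqEcard subsetT cardsT card_ord (eq_leq (esym cardS)).
  rewrite setCT big_set0 mul1n.
  have all_tuples (T : finType) (P : pred (seq T)) : P [::] -> #|[set t : 0.-tuple T | P t]| = 1.
    by move=> P0; rewrite -(expn0 #|T|) -card_tuple; apply: eq_card => t; rewrite inE tuple0 P0.
  rewrite [LHS](all_tuples _ (all_park setT)) //.
  rewrite [RHS](all_tuples _ (fun s => ord_max \notin circ_park _ s)) //.
  exact: max_notin_widen.
(* The circle allows one more preference, [ord_max]; a car with it occupies the extra spot, so its
   term vanishes, as does that of a car failing on the street. *)
rewrite parkings_cons leaving_cons big_ord_recr /= circ_free_max.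
rewrite leaving_full ?setU11 // addn0 big_distrr /=; apply: eq_bigr => a _.
rewrite circ_free_widen; case: first_free (first_freeP S a) => [j [_ jS _] | _]; last first.
  by rewrite leaving_full ?muln0 // setU11.
rewrite IHm; last by rewrite cardsU1 jS addnCA addnA add1n.
rewrite mulnA imsetU1; congr (_ * _).
rewrite [RHS](bigD1 j) ?inE //=; congr (_ * _); apply: eq_bigl => i.
by rewrite !inE negb_or andbC.
Qed.

End LinearParking.

(** * The two counts and the bijection *)

Lemma card_IPF n : #|{: IPF n}| = n`! * leaving (@ord_max n) n set0.
Proof.
transitivity (parkings n (@set0 'I_n)).
  rewrite card_sig /parkings.
  pose zipt (ab : n.-tuple 'I_n * n.-tuple 'I_n) := [tuple of zip ab.1 ab.2].
  have zip_inj : injective zipt.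
    move=> [a b] [c d] /(congr1 val) /= eq_zip; congr (_, _); apply: val_inj.
      by rewrite -[LHS](@unzip1_zip _ _ _ b) ?eq_zip ?unzip1_zip ?size_tuple.
    by rewrite -[LHS](@unzip2_zip _ _ a) ?eq_zip ?unzip2_zip ?size_tuple.
  rewrite -cardsE -(card_imset _ zip_inj); apply: eq_card => t.
  apply/imsetP/idP => [[ab] | ]; rewrite !inE; first by move=> ab_ipf ->.
  move=> tP.
  have Dt : t = zipt ([tuple of unzip1 t], [tuple of unzip2 t]).
    by apply: val_inj; rewrite /= zip_unzip.
  by exists ([tuple of unzip1 t], [tuple of unzip2 t]); rewrite // inE /is_ipf /= zip_unzip.
(* With no spot occupied, the product of [n - j] runs over all [j < n] and is the falling factorial
   [n ^_ n]. *)
rewrite parkings_leaving ?cards0 ?addn0 // imset0 -ffactnn ffact_prod.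
by congr (_ * _); apply: eq_bigl => j; rewrite !inE.
Qed.

Theorem theorem4p5 (n : nat) (n_ge1 : 1 <= n) :
  exists f : IPF n -> edge_labeled_tree n, bijective f.
Proof.
have eq_card : #|{: IPF n}| = #|{: edge_labeled_tree n}|.
  rewrite card_IPF card_edge_labeled_tree mulnC; congr (_ * _).
  (* Both numbers are known after multiplication by [n.+1], when each equals [n.+1 ^ n]. *)
  apply/eqP; rewrite -(eqn_pmul2l (ltn0Sn n)); apply/eqP.
  by rewrite leaving_total card_spanning_trees.
exists (fun x => enum_val (cast_ord eq_card (enum_rank x))).
exists (fun y => enum_val (cast_ord (esym eq_card) (enum_rank y))) => x.
  by rewrite enum_valK cast_ordK enum_rankK.
by rewrite enum_valK cast_ordKV enum_rankK.
Qed.
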